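(* Let $(\mathcal C,\otimes,I,\alpha,\lambda,\rho,\gamma)$ be a symmetric monoidal category, let $\mathcal G=((G,\le),i,\ast)$ be a pomonoid with centre $\mathcal Z(\mathcal G)=((Z(G),\le),i,\ast)$, and let $(\mathcal T,\eta,\mu,\tau)$ be a strong $\mathcal G$-graded monad on $\mathcal C$. Suppose $\mathcal T$ is centralisable, and for every $z\in Z(G)$ and every object $X$ of $\mathcal C$ let $(\mathcal Z^{z}X,\ \iota^{z}_X:\mathcal Z^{z}X\to \mathcal T^{z}X)$ denote the terminal graded central cone of $\mathcal T$ at $(z,X)$. Then the assignment $(z,X)\mapsto \mathcal Z^{z}X$ extends to a commutative (strong) $\mathcal Z(\mathcal G)$-graded monad $(\mathcal Z,\eta^{\mathcal Z},\mu^{\mathcal Z},\tau^{\mathcal Z})$ on $\mathcal C$ (called the centre of $\mathcal T$). Moreover, $\mathcal Z$ is a commutative $\mathcal Z(\mathcal G)$-graded submonad of $\mathcal T$, and the morphisms $\iota^{z}_X:\mathcal Z^{z}X\to\mathcal T^{z}X$ determine a monomorphism of strong graded monads $\mathcal Z\to\mathcal T$ (over the inclusion of pomonoids $\mathcal Z(\mathcal G)\subseteq\mathcal G$).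
   Context: A pomonoid $\mathcal G=((G,\le),i,\ast)$ is a monoid $(G,i,\ast)$ with a partial order $\le$ such that $w\le x$ and $y\le z$ imply $w\ast y\le x\ast z$. Its centre is $Z(G)=\{z\in G\mid \forall b\in G,\ z\ast b=b\ast z\}$, and $\mathcal Z(\mathcal G)=((Z(G),\le),i,\ast)$ is the pomonoid with the restricted structure. A $\mathcal G$-graded monad on $\mathcal C$ consists of: an endofunctor $\mathcal T^{a}:\mathcal C\to\mathcal C$ for each $a\in G$; a natural transformation $\eta:\mathrm{Id}\to\mathcal T^{i}$; natural transformations $\mu^{a,b}:\mathcal T^{a}\mathcal T^{b}\to\mathcal T^{a\ast b}$ for all $a,b\in G$; and natural transformations $\mathcal T^{a\le a'}:\mathcal T^{a}\to\mathcal T^{a'}$ whenever $a\le a'$; such that for all $a,b,c\in G$: $\mu^{i,a}\circ\eta_{\mathcal T^{a}}=\mathrm{id}=\mu^{a,i}\circ\mathcal T^{a}\eta$; $\mu^{a\ast b,c}\circ\mu^{a,b}_{\mathcal T^{c}}=\mu^{a,b\ast c}\circ\mathcal T^{a}\mu^{b,c}$; $\mathcal T^{a\le a}=\mathrm{id}$; $\mathcal T^{a'\le a''}\circ\mathcal T^{a\le a'}=\mathcal T^{a\le a''}$; and $\mathcal T^{a\ast b\le a'\ast b'}\circ\mu^{a,b}=\mu^{a',b'}\circ(\mathcal T^{a\le a'}\cdot\mathcal T^{b\le b'})$ (horizontal composite) whenever $a\le a'$, $b\le b'$. It is strong if equipped with natural transformations $\tau^{a}_{X,Y}:X\otimes\mathcal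 T^{a}Y\to\mathcal T^{a}(X\otimes Y)$, $a\in G$ (graded strength), satisfying: $\mathcal T^{a}\lambda_Y\circ\tau^{a}_{I,Y}=\lambda_{\mathcal T^{a}Y}$; $\mathcal T^{a}\alpha_{X,Y,W}\circ\tau^{a}_{X\otimes Y,W}=\tau^{a}_{X,Y\otimes W}\circ(X\otimes\tau^{a}_{Y,W})\circ\alpha_{X,Y,\mathcal T^{a}W}$; $\tau^{i}_{X,Y}\circ(X\otimes\eta_Y)=\eta_{X\otimes Y}$; $\tau^{a\ast b}_{X,Y}\circ(X\otimes\mu^{a,b}_Y)=\mu^{a,b}_{X\otimes Y}\circ\mathcal T^{a}\tau^{b}_{X,Y}\circ\tau^{a}_{X,\mathcal T^{b}Y}$; and $\tau^{a'}_{X,Y}\circ(X\otimes\mathcal T^{a\le a'}_Y)=\mathcal T^{a\le a'}_{X\otimes Y}\circ\tau^{a}_{X,Y}$ for $a\le a'$. Here $\lambda_X:I\otimes X\to X$, $\alpha_{X,Y,W}:(X\otimes Y)\otimes W\to X\otimes(Y\otimes W)$, and an object also denotes its identity morphism. The graded costrength is $\tau'^{a}_{X,Y}=\mathcal T^{a}(\gamma_{Y,X})\circ\tau^{a}_{Y,X}\circ\gamma_{\mathcal T^{a}X,Y}:\mathcal T^{a}X\otimes Y\to\mathcal T^{a}(X\otimes Y)$, where $\gamma$ is the symmetry. A strong graded monad $(\mathcal P,\eta,\mu,\tau)$ graded by a commutative pomonoid (such as $\mathcal Z(\mathcal G)$) is commutative if for all gradations $a,b$ and objects $X,Y$, $$\mu^{a,b}_{X\otimes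 Y}\circ\mathcal P^{a}\tau^{b}_{X,Y}\circ\tau'^{a}_{X,\mathcal P^{b}Y}=\mu^{b,a}_{X\otimes Y}\circ\mathcal P^{b}\tau'^{a}_{X,Y}\circ\tau^{b}_{\mathcal P^{a}X,Y}:\ \mathcal P^{a}X\otimes\mathcal P^{b}Y\to\mathcal P^{a\ast b}(X\otimes Y)=\mathcal P^{b\ast a}(X\otimes Y).$$ For $z\in Z(G)$ and an object $X$, a graded central cone of $\mathcal T$ at $(z,X)$ is a pair $(Z,\iota)$ of an object $Z$ and a morphism $\iota:Z\to\mathcal T^{z}X$ such that for every object $Y$ and every $b\in G$, $$\mu^{z,b}_{X\otimes Y}\circ\mathcal T^{z}\tau^{b}_{X,Y}\circ\tau'^{z}_{X,\mathcal T^{b}Y}\circ(\iota\otimes\mathcal T^{b}Y)=\mu^{b,z}_{X\otimes Y}\circ\mathcal T^{b}\tau'^{z}_{X,Y}\circ\tau^{b}_{\mathcal T^{z}X,Y}\circ(\iota\otimes\mathcal T^{b}Y)$$ as morphisms $Z\otimes\mathcal T^{b}Y\to\mathcal T^{z\ast b}(X\otimes Y)=\mathcal T^{b\ast z}(X\otimes Y)$. A morphism of graded central cones $(Z',\iota')\to(Z,\iota)$ is a morphism $\varphi:Z'\to Z$ with $\iota\circ\varphi=\iota'$; a terminal graded central cone at $(z,X)$ is a terminal object of the resulting category. $\mathcal T$ is centralisable if a terminal graded central cone at $(z,X)$ exists for every $z\in Z(G)$ and every object $X$. A morphism of strong graded monads from a $\mathcal Z(\mathcal G)$-graded strong monad $\mathcal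 S$ to $\mathcal T$ over the inclusion $Z(G)\subseteq G$ is a family of natural transformations $\iota^{z}:\mathcal S^{z}\Rightarrow\mathcal T^{z}$, $z\in Z(G)$, such that for all $z,w\in Z(G)$ and objects $X,Y$: $\iota^{i}_X\circ\eta^{\mathcal S}_X=\eta_X$; $\iota^{z\ast w}_X\circ(\mu^{\mathcal S})^{z,w}_X=\mu^{z,w}_X\circ\mathcal T^{z}\iota^{w}_X\circ\iota^{z}_{\mathcal S^{w}X}$; $\iota^{z}_{X\otimes Y}\circ(\tau^{\mathcal S})^{z}_{X,Y}=\tau^{z}_{X,Y}\circ(X\otimes\iota^{z}_Y)$; and $\iota^{z'}\circ\mathcal S^{z\le z'}=\mathcal T^{z\le z'}\circ\iota^{z}$ for $z\le z'$. It is a monomorphism (and $\mathcal S$ is a $\mathcal Z(\mathcal G)$-graded submonad of $\mathcal T$) when every component $\iota^{z}_X$ is a monomorphism in $\mathcal C$. *)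

(* Defs.v *)
From Stdlib Require Import Relation_Definitions ProofIrrelevance.

Set Implicit Arguments.
Unset Strict Implicit.

Declare Scope cat_scope.
Delimit Scope cat_scope with cat.
Open Scope cat_scope.

Record Category := {
  ob :> Type;
  hom : ob -> ob -> Type;
  idm : forall X, hom X X;
  comp : forall X Y W, hom Y W -> hom X Y -> hom X W;
  comp_idl : forall X Y (f : hom X Y), comp (idm Y) f = f;
  comp_idr : forall X Y (f : hom X Y), comp f (idm X) = f;
  comp_assoc : forall X Y V W (h : hom V W) (g : hom Y V) (f : hom X Y),
    comp (comp h g) f = comp h (comp g f)
}.
Arguments hom {c} _ _.
Arguments idm {c} X.
Arguments comp {c X Y W} _ _.

Notation "g ∘ f" := (comp g f) (at level 40, left associativity) : cat_scope.

Definition is_iso (C : Category) (X Y : C) (f : hom X Y) : Prop :=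
  exists g : hom Y X, g ∘ f = idm X /\ f ∘ g = idm Y.

Definition is_mono (C : Category) (X Y : C) (f : hom X Y) : Prop :=
  forall (W : C) (g h : hom W X), f ∘ g = f ∘ h -> g = h.

Definition is_terminal (C : Category) (X : C) : Prop :=
  forall W : C, exists f : hom W X, forall g : hom W X, g = f.

Record Functor (C D : Category) := {
  fobj :> C -> D;
  fmap : forall X Y, hom X Y -> hom (fobj X) (fobj Y);
  fmap_id : forall X, fmap (idm X) = idm (fobj X);
  fmap_comp : forall X Y W (g : hom Y W) (f : hom X Y),
    fmap (g ∘ f) = fmap g ∘ fmap f
}.
Arguments fmap {C D} _ {X Y} _.

Definition functor_id (C : Category) : Functor C C :=
  {| fobj := fun X => X;
     fmap := fun X Y f => f;
     fmap_id := fun X => eq_refl;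
     fmap_comp := fun X Y W g f => eq_refl |}.

Lemma functor_comp_id (C D E : Category) (F : Functor D E) (H : Functor C D)
  (X : C) : fmap F (fmap H (idm X)) = idm (F (H X)).
Proof. rewrite fmap_id; apply fmap_id. Qed.

Lemma functor_comp_comp (C D E : Category) (F : Functor D E) (H : Functor C D)
  (X Y W : C) (g : hom Y W) (f : hom X Y) :
  fmap F (fmap H (g ∘ f)) = fmap F (fmap H g) ∘ fmap F (fmap H f).
Proof. rewrite fmap_comp; apply fmap_comp. Qed.

Definition functor_comp (C D E : Category) (F : Functor D E) (H : Functor C D) :
  Functor C E :=
  {| fobj := fun X => F (H X);
     fmap := fun X Y f => fmap F (fmap H f);
     fmap_id := functor_comp_id F H;
     fmap_comp := functor_comp_comp F H |}.

Record NatTrans (C D : Category) (F H : Functor C D) := {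
  component :> forall X : C, hom (F X) (H X);
  naturality : forall X Y (f : hom X Y),
    component Y ∘ fmap F f = fmap H f ∘ component X
}.

Record SymMonCat := {
  smc_cat :> Category;
  tens : smc_cat -> smc_cat -> smc_cat;
  tensm : forall X X' Y Y' : smc_cat,
    hom X X' -> hom Y Y' -> hom (tens X Y) (tens X' Y');
  tensm_id : forall X Y, tensm (idm X) (idm Y) = idm (tens X Y);
  tensm_comp : forall X X' X'' Y Y' Y''
      (f' : hom X' X'') (f : hom X X') (g' : hom Y' Y'') (g : hom Y Y'),
    tensm (f' ∘ f) (g' ∘ g) = tensm f' g' ∘ tensm f g;
  munit : smc_cat;
  massoc : forall X Y W : smc_cat, hom (tens (tens X Y) W) (tens X (tens Y W));
  mlunit : forall X : smc_cat, hom (tens munit X) X;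
  mrunit : forall X : smc_cat, hom (tens X munit) X;
  msym : forall X Y : smc_cat, hom (tens X Y) (tens Y X);
  massoc_iso : forall X Y W, is_iso (massoc X Y W);
  mlunit_iso : forall X, is_iso (mlunit X);
  mrunit_iso : forall X, is_iso (mrunit X);
  massoc_nat : forall X X' Y Y' W W'
      (f : hom X X') (g : hom Y Y') (h : hom W W'),
    massoc X' Y' W' ∘ tensm (tensm f g) h
    = tensm f (tensm g h) ∘ massoc X Y W;
  mlunit_nat : forall X X' (f : hom X X'),
    mlunit X' ∘ tensm (idm munit) f = f ∘ mlunit X;
  mrunit_nat : forall X X' (f : hom X X'),
    mrunit X' ∘ tensm f (idm munit) = f ∘ mrunit X;
  msym_nat : forall X X' Y Y' (f : hom X X') (g : hom Y Y'),
    msym X' Y' ∘ tensm f g = tensm g f ∘ msym X Y;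
  triangle : forall X Y,
    tensm (idm X) (mlunit Y) ∘ massoc X munit Y = tensm (mrunit X) (idm Y);
  pentagon : forall V W X Y,
    massoc V W (tens X Y) ∘ massoc (tens V W) X Y
    = tensm (idm V) (massoc W X Y) ∘ massoc V (tens W X) Y
      ∘ tensm (massoc V W X) (idm Y);
  msym_invol : forall X Y, msym Y X ∘ msym X Y = idm (tens X Y);
  hexagon : forall X Y W,
    massoc Y W X ∘ msym X (tens Y W) ∘ massoc X Y W
    = tensm (idm Y) (msym X W) ∘ massoc Y X W ∘ tensm (msym X Y) (idm W)
}.
Arguments tens {_} _ _.
Arguments tensm {_ _ _ _ _} _ _.
Arguments munit {s}.
Arguments massoc {s} X Y W.
Arguments mlunit {s} X.
Arguments mrunit {s} X.
Arguments msym {s} X Y.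

Notation "X ⊗ Y" := (tens X Y) (at level 34, left associativity) : cat_scope.
Notation "f ⊗₁ g" := (tensm f g) (at level 34, left associativity) : cat_scope.

Record Pomonoid := {
  pm_car :> Type;
  pm_le : pm_car -> pm_car -> Prop;
  pm_one : pm_car;
  pm_mul : pm_car -> pm_car -> pm_car;
  pm_order : order pm_car pm_le;
  pm_mul1l : forall a, pm_mul pm_one a = a;
  pm_mul1r : forall a, pm_mul a pm_one = a;
  pm_mulA : forall a b c, pm_mul (pm_mul a b) c = pm_mul a (pm_mul b c);
  pm_mono : forall w x y z,
    pm_le w x -> pm_le y z -> pm_le (pm_mul w y) (pm_mul x z)
}.
Arguments pm_le {p} _ _.
Arguments pm_one {p}.
Arguments pm_mul {p} _ _.
Arguments pm_mono {p w x y z} _ _.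

Notation "a ≼ b" := (pm_le a b) (at level 70, no associativity) : cat_scope.
Notation "a ∗ b" := (pm_mul a b) (at level 40, left associativity) : cat_scope.

Definition is_central (G : Pomonoid) (z : G) : Prop :=
  forall b : G, z ∗ b = b ∗ z.

Definition center_car (G : Pomonoid) : Type := {z : G | is_central z}.

Section Center.
Variable G : Pomonoid.

Lemma central_one : is_central (pm_one : G).
Proof. intro b; rewrite pm_mul1l, pm_mul1r; reflexivity. Qed.

Lemma central_mul (z w : G) : is_central z -> is_central w -> is_central (z ∗ w).
Proof.
intros hz hw b.
rewrite pm_mulA, (hw b), <- pm_mulA, (hz b), pm_mulA; reflexivity.
Qed.

Definition center_one : center_car G := exist _ pm_one central_one.

Definition center_mul (z w : center_car G) : center_car G :=
  exist _ (proj1_sig z ∗ proj1_sig w)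
          (central_mul (proj2_sig z) (proj2_sig w)).

Definition center_le (z w : center_car G) : Prop := proj1_sig z ≼ proj1_sig w.

Lemma center_eq (z w : center_car G) : proj1_sig z = proj1_sig w -> z = w.
Proof.
destruct z as [z hz], w as [w hw]; simpl; intros e.
apply subset_eq_compat; exact e.
Qed.

Lemma center_order : order (center_car G) center_le.
Proof.
destruct (pm_order G) as [r t s]; split.
- intro z; apply r.
- intros x y z; apply t.
- intros x y h k; apply center_eq; apply s; assumption.
Qed.

Lemma center_mul1l (z : center_car G) : center_mul center_one z = z.
Proof. apply center_eq; apply pm_mul1l. Qed.

Lemma center_mul1r (z : center_car G) : center_mul z center_one = z.
Proof. apply center_eq; apply pm_mul1r. Qed.

Lemma center_mulA (x y z : center_car G) :
  center_mul (center_mul x y) z = center_mul x (center_mul y z).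
Proof. apply center_eq; apply pm_mulA. Qed.

Lemma center_mono (w x y z : center_car G) :
  center_le w x -> center_le y z -> center_le (center_mul w y) (center_mul x z).
Proof. apply pm_mono. Qed.

Definition center : Pomonoid :=
  {| pm_car := center_car G;
     pm_le := center_le;
     pm_one := center_one;
     pm_mul := center_mul;
     pm_order := center_order;
     pm_mul1l := center_mul1l;
     pm_mul1r := center_mul1r;
     pm_mulA := center_mulA;
     pm_mono := center_mono |}.

Lemma center_comm (z w : center) : z ∗ w = w ∗ z.
Proof. apply center_eq; apply (proj2_sig z). Qed.

Definition center_val (z : center) : G := proj1_sig z.

Lemma center_valP (z : center) (b : G) : center_val z ∗ b = b ∗ center_val z.
Proof. exact (proj2_sig z b). Qed.

End Center.

(* [T^a X] and [T^b X] are the same object when [a = b]; [gcast] is the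
   identity morphism between them, transported along that equality.  It stands
   for the tacit identifications along [(a ∗ b) ∗ c = a ∗ (b ∗ c)],
   [pm_one ∗ a = a = a ∗ pm_one] and [z ∗ b = b ∗ z]. *)
Definition gcast (C : Category) (G : Type) (T : G -> Functor C C)
    (a b : G) (e : a = b) (X : C) : hom (T a X) (T b X) :=
  match e in _ = c return hom (T a X) (T c X) with
  | eq_refl => idm (T a X)
  end.
Arguments gcast {C G} T {a b} e X.

(* [gm_le] takes the proof of [a ≼ a'] as an argument; [gm_le_refl] and
   [gm_le_trans] range over all such proofs and so make it independent of the
   one chosen. *)
Record GradedMonad (C : Category) (G : Pomonoid) := {
  gm_fun :> G -> Functor C C;
  gm_eta : NatTrans (functor_id C) (gm_fun pm_one);
  gm_mu : forall a b : G,
    NatTrans (functor_comp (gm_fun a) (gm_fun b)) (gm_fun (a ∗ b));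
  gm_le : forall a a' : G, a ≼ a' -> NatTrans (gm_fun a) (gm_fun a');
  gm_unitl : forall (a : G) (X : C),
    gcast gm_fun (pm_mul1l a) X ∘ (gm_mu pm_one a X ∘ gm_eta (gm_fun a X))
    = idm (gm_fun a X);
  gm_unitr : forall (a : G) (X : C),
    gcast gm_fun (pm_mul1r a) X ∘ (gm_mu a pm_one X ∘ fmap (gm_fun a) (gm_eta X))
    = idm (gm_fun a X);
  gm_assoc : forall (a b c : G) (X : C),
    gcast gm_fun (pm_mulA a b c) X
      ∘ (gm_mu (a ∗ b) c X ∘ gm_mu a b (gm_fun c X))
    = gm_mu a (b ∗ c) X ∘ fmap (gm_fun a) (gm_mu b c X);
  gm_le_refl : forall (a : G) (h : a ≼ a) (X : C),
    gm_le h X = idm (gm_fun a X);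
  gm_le_trans : forall (a a' a'' : G) (h : a ≼ a') (h' : a' ≼ a'')
      (h'' : a ≼ a'') (X : C),
    gm_le h' X ∘ gm_le h X = gm_le h'' X;
  gm_le_mu : forall (a a' b b' : G) (h : a ≼ a') (k : b ≼ b') (X : C),
    gm_le (pm_mono h k) X ∘ gm_mu a b X
    = gm_mu a' b' X ∘ (gm_le h (gm_fun b' X) ∘ fmap (gm_fun a) (gm_le k X))
}.
Arguments gm_eta {C G} g.
Arguments gm_mu {C G} g a b.
Arguments gm_le {C G} g {a a'} _.

Record StrongGradedMonad (C : SymMonCat) (G : Pomonoid) := {
  sgm_monad :> GradedMonad C G;
  str : forall (a : G) (X Y : C),
    hom (X ⊗ sgm_monad a Y) (sgm_monad a (X ⊗ Y));
  str_nat : forall (a : G) (X X' Y Y' : C) (f : hom X X') (g : hom Y Y'),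
    str a X' Y' ∘ (f ⊗₁ fmap (sgm_monad a) g)
    = fmap (sgm_monad a) (f ⊗₁ g) ∘ str a X Y;
  str_unit : forall (a : G) (Y : C),
    fmap (sgm_monad a) (mlunit Y) ∘ str a munit Y = mlunit (sgm_monad a Y);
  str_assoc : forall (a : G) (X Y W : C),
    fmap (sgm_monad a) (massoc X Y W) ∘ str a (X ⊗ Y) W
    = str a X (Y ⊗ W) ∘ (idm X ⊗₁ str a Y W) ∘ massoc X Y (sgm_monad a W);
  str_eta : forall X Y : C,
    str pm_one X Y ∘ (idm X ⊗₁ gm_eta sgm_monad Y) = gm_eta sgm_monad (X ⊗ Y);
  str_mu : forall (a b : G) (X Y : C),
    str (a ∗ b) X Y ∘ (idm X ⊗₁ gm_mu sgm_monad a b Y)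
    = gm_mu sgm_monad a b (X ⊗ Y) ∘ fmap (sgm_monad a) (str b X Y)
      ∘ str a X (sgm_monad b Y);
  str_le : forall (a a' : G) (h : a ≼ a') (X Y : C),
    str a' X Y ∘ (idm X ⊗₁ gm_le sgm_monad h Y)
    = gm_le sgm_monad h (X ⊗ Y) ∘ str a X Y
}.
Arguments str {C G} s a X Y.

Definition costr (C : SymMonCat) (G : Pomonoid) (T : StrongGradedMonad C G)
    (a : G) (X Y : C) : hom (T a X ⊗ Y) (T a (X ⊗ Y)) :=
  fmap (T a) (msym Y X) ∘ str T a Y X ∘ msym (T a X) Y.

(* The two composites [T^a X ⊗ T^b Y -> T^(a ∗ b) (X ⊗ Y)] and
   [-> T^(b ∗ a) (X ⊗ Y)], with the effect of the left, resp. right, factor first. *)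
Definition dstr_l (C : SymMonCat) (G : Pomonoid) (T : StrongGradedMonad C G)
    (a b : G) (X Y : C) : hom (T a X ⊗ T b Y) (T (a ∗ b) (X ⊗ Y)) :=
  gm_mu T a b (X ⊗ Y) ∘ fmap (T a) (str T b X Y) ∘ costr T a X (T b Y).

Definition dstr_r (C : SymMonCat) (G : Pomonoid) (T : StrongGradedMonad C G)
    (a b : G) (X Y : C) : hom (T a X ⊗ T b Y) (T (b ∗ a) (X ⊗ Y)) :=
  gm_mu T b a (X ⊗ Y) ∘ fmap (T b) (costr T a X Y) ∘ str T b (T a X) Y.

Definition is_commutative (C : SymMonCat) (P : Pomonoid)
    (P_comm : forall a b : P, a ∗ b = b ∗ a) (T : StrongGradedMonad C P) : Prop :=
  forall (a b : P) (X Y : C),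
    gcast T (P_comm a b) (X ⊗ Y) ∘ dstr_l T a b X Y = dstr_r T a b X Y.

Section CentralCones.
Variables (C : SymMonCat) (G : Pomonoid) (T : StrongGradedMonad C G).
Variables (z : center G) (X : C).

Record GradedCentralCone := {
  cone_ob : C;
  cone_mor : hom cone_ob (T (center_val z) X);
  cone_central : forall (Y : C) (b : G),
    gcast T (center_valP z b) (X ⊗ Y)
      ∘ (dstr_l T (center_val z) b X Y ∘ (cone_mor ⊗₁ idm (T b Y)))
    = dstr_r T (center_val z) b X Y ∘ (cone_mor ⊗₁ idm (T b Y))
}.

Definition cone_hom (K' K : GradedCentralCone) : Type :=
  {phi : hom (cone_ob K') (cone_ob K) | cone_mor K ∘ phi = cone_mor K'}.

Lemma cone_hom_eq (K' K : GradedCentralCone) (f g : cone_hom K' K) :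
  proj1_sig f = proj1_sig g -> f = g.
Proof.
destruct f as [f hf], g as [g hg]; simpl; intros e.
apply subset_eq_compat; exact e.
Qed.

Definition cone_id (K : GradedCentralCone) : cone_hom K K :=
  exist _ (idm (cone_ob K)) (comp_idr (cone_mor K)).

Lemma cone_comp_proof (K K' K'' : GradedCentralCone)
    (g : cone_hom K' K'') (f : cone_hom K K') :
  cone_mor K'' ∘ (proj1_sig g ∘ proj1_sig f) = cone_mor K.
Proof.
rewrite <- comp_assoc, (proj2_sig g); exact (proj2_sig f).
Qed.

Definition cone_comp (K K' K'' : GradedCentralCone)
    (g : cone_hom K' K'') (f : cone_hom K K') : cone_hom K K'' :=
  exist _ (proj1_sig g ∘ proj1_sig f) (cone_comp_proof g f).

Definition ConeCategory : Category.
Proof.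
refine {| ob := GradedCentralCone; hom := cone_hom; idm := cone_id;
          comp := cone_comp |}.
- intros; apply cone_hom_eq; apply comp_idl.
- intros; apply cone_hom_eq; apply comp_idr.
- intros; apply cone_hom_eq; apply comp_assoc.
Defined.

Definition is_terminal_cone (K : GradedCentralCone) : Prop :=
  is_terminal (K : ConeCategory).

End CentralCones.
Arguments GradedCentralCone {C G} T z X.
Arguments is_terminal_cone {C G T z X} K.

Definition is_centralisable (C : SymMonCat) (G : Pomonoid)
    (T : StrongGradedMonad C G) : Prop :=
  forall (z : center G) (X : C),
    exists K : GradedCentralCone T z X, is_terminal_cone K.

Record CenterMorphism (C : SymMonCat) (G : Pomonoid)
    (S : StrongGradedMonad C (center G)) (T : StrongGradedMonad C G) := {
  cm_nat :> forall z : center G, NatTrans (S z) (T (center_val z));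
  cm_eta : forall X : C, cm_nat pm_one X ∘ gm_eta S X = gm_eta T X;
  cm_mu : forall (z w : center G) (X : C),
    cm_nat (z ∗ w) X ∘ gm_mu S z w X
    = gm_mu T (center_val z) (center_val w) X
      ∘ fmap (T (center_val z)) (cm_nat w X) ∘ cm_nat z (S w X);
  cm_str : forall (z : center G) (X Y : C),
    cm_nat z (X ⊗ Y) ∘ str S z X Y
    = str T (center_val z) X Y ∘ (idm X ⊗₁ cm_nat z Y);
  cm_le : forall (z z' : center G) (h : z ≼ z') (X : C),
    cm_nat z' X ∘ gm_le S h X
    = gm_le T (h : center_val z ≼ center_val z') X ∘ cm_nat z X
}.

Definition is_monomorphism (C : SymMonCat) (G : Pomonoid)
    (S : StrongGradedMonad C (center G)) (T : StrongGradedMonad C G)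
    (iota : CenterMorphism S T) : Prop :=
  forall (z : center G) (X : C), is_mono (iota z X).

(* Main.v *)
(* A graded arrow [W -> X] is a grade [a] together with a morphism [W -> T^a X].
   Graded arrows form a Kleisli category in which the strength and costrength
   provide whiskerings [A ⋊ f] and [f ⋉ B], functorial in [f] and compatible
   with the associator: a premonoidal structure.  A morphism into [T^z X] with
   [z] central is a graded central cone exactly when its graded arrow is central,
   i.e. [f ⋉ V] and [X ⋊ g] commute for every [g].  Central arrows contain the pure
   arrows and are closed under composition, whiskering and raising the grade to
   a central one, so each structure map of [T], composed with [iota], factors
   through the terminal cone.  As [iota] is monic, the laws of the centre follow from
   those of the Kleisli category, and commutativity is the centrality of
   [iota]. *)
From Stdlib Require Import ProofIrrelevance IndefiniteDescription.
From Stdlib Require Import Relation_Definitions.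
Require Import Defs.

Set Implicit Arguments.
Unset Strict Implicit.

(** * The Kleisli category of graded arrows *)

Section Kleisli.
Variables (C : SymMonCat) (G : Pomonoid) (T : StrongGradedMonad C G).

(* Bundling the grade into the morphism turns the laws of a graded monad, which
   hold up to [gcast], into plain equations. *)
Definition kl (W X : C) : Type := {a : G & hom W (T a X)}.

Definition arr (a : G) (W X : C) (x : hom W (T a X)) : kl W X := existT _ a x.

(** The passage between equations up to [gcast] and equations of graded arrows. Injectivity of the
    second projection ([inj_pairT2]) rests on proof irrelevance. *)
Lemma arr_cast (a b : G) (e : a = b) (W X : C)
    (x : hom W (T a X)) (y : hom W (T b X)) :
  gcast T e X ∘ x = y <-> arr x = arr y.
Proof.
destruct e; simpl; rewrite comp_idl; split.
- intros ->; reflexivity.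
- intros H; apply inj_pairT2 in H; exact H.
Qed.

Lemma arr_inj (a : G) (W X : C) (x y : hom W (T a X)) : arr x = arr y -> x = y.
Proof. apply inj_pairT2. Qed.

(* Types [gm_eta] and [gm_mu] without [functor_id] and [functor_comp], which
   would block rewriting. *)
Definition eta (X : C) : hom X (T pm_one X) := gm_eta T X.
Definition mu (a b : G) (X : C) : hom (T a (T b X)) (T (a ∗ b) X) :=
  gm_mu T a b X.

Lemma eta_nat (X Y : C) (f : hom X Y) : fmap (T pm_one) f ∘ eta X = eta Y ∘ f.
Proof. symmetry; exact (naturality (gm_eta T) f). Qed.

Lemma mu_nat (a b : G) (X Y : C) (f : hom X Y) :
  fmap (T (a ∗ b)) f ∘ mu a b X = mu a b Y ∘ fmap (T a) (fmap (T b) f).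
Proof. symmetry; exact (naturality (gm_mu T a b) f). Qed.

Lemma mu_unitl (a : G) (X : C) :
  gcast T (pm_mul1l a) X ∘ (mu pm_one a X ∘ eta (T a X)) = idm (T a X).
Proof. exact (gm_unitl T a X). Qed.

Lemma mu_unitr (a : G) (X : C) :
  gcast T (pm_mul1r a) X ∘ (mu a pm_one X ∘ fmap (T a) (eta X)) = idm (T a X).
Proof. exact (gm_unitr T a X). Qed.

Lemma mu_assoc (a b c : G) (X : C) :
  gcast T (pm_mulA a b c) X ∘ (mu (a ∗ b) c X ∘ mu a b (T c X))
  = mu a (b ∗ c) X ∘ fmap (T a) (mu b c X).
Proof. exact (gm_assoc T a b c X). Qed.

Lemma str_eta' (X Y : C) : str T pm_one X Y ∘ (idm X ⊗₁ eta Y) = eta (X ⊗ Y).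
Proof. exact (str_eta T X Y). Qed.

Lemma str_mu' (a b : G) (X Y : C) :
  str T (a ∗ b) X Y ∘ (idm X ⊗₁ mu a b Y)
  = mu a b (X ⊗ Y) ∘ fmap (T a) (str T b X Y) ∘ str T a X (T b Y).
Proof. exact (str_mu T a b X Y). Qed.

Lemma le_nat (a b : G) (h : a ≼ b) (X Y : C) (f : hom X Y) :
  fmap (T b) f ∘ gm_le T h X = gm_le T h Y ∘ fmap (T a) f.
Proof. symmetry; exact (naturality (gm_le T h) f). Qed.

Lemma le_mu (a a' b b' : G) (h : a ≼ a') (k : b ≼ b') (X : C) :
  gm_le T (pm_mono h k) X ∘ mu a b X
  = mu a' b' X ∘ (gm_le T h (T b' X) ∘ fmap (T a) (gm_le T k X)).
Proof. exact (gm_le_mu T h k X). Qed.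

Definition pure (W X : C) (r : hom W X) : kl W X := arr (eta X ∘ r).

Definition kbind (W V X : C) (f : kl W V) (g : kl V X) : kl W X :=
  arr (mu (projT1 f) (projT1 g) X ∘ (fmap (T (projT1 f)) (projT2 g) ∘ projT2 f)).

Notation "f >=> g" := (kbind f g) (at level 41, right associativity).

(** Applies an equation [g ∘ f = h] inside a right-nested composite; [bind_prefix] does the same for
    [>=>]. *)
Lemma comp_prefix (X Y W V : C) (g : hom Y W) (f : hom X Y) (h : hom X W)
    (H : g ∘ f = h) (k : hom V X) : g ∘ (f ∘ k) = h ∘ k.
Proof. rewrite <- comp_assoc, H; reflexivity. Qed.

Lemma kbindA (W V U X : C) (f : kl W V) (g : kl V U) (h : kl U X) :
  (f >=> g) >=> h = f >=> (g >=> h).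
Proof.
destruct f as [a f], g as [b g], h as [c h].
apply (arr_cast (pm_mulA a b c)); simpl.
rewrite !fmap_comp, (comp_prefix (mu_nat _ _ _)), !comp_assoc.
rewrite <- (comp_assoc (mu a (b ∗ c) X)), <- mu_assoc, !comp_assoc; reflexivity.
Qed.

Lemma pure_bind (a : G) (W V X : C) (r : hom W V) (x : hom V (T a X)) :
  pure r >=> arr x = arr (x ∘ r).
Proof.
apply (arr_cast (pm_mul1l a)); simpl.
rewrite (comp_prefix (eta_nat _)), !comp_assoc, <- (comp_assoc (mu _ _ _)).
rewrite (comp_prefix (mu_unitl a X)), comp_idl; reflexivity.
Qed.

Lemma bind_pure (a : G) (W V X : C) (x : hom W (T a V)) (r : hom V X) :
  arr x >=> pure r = arr (fmap (T a) r ∘ x).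
Proof.
apply (arr_cast (pm_mul1r a)); simpl.
rewrite fmap_comp, !comp_assoc, <- (comp_assoc (mu _ _ _)).
rewrite (comp_prefix (mu_unitr a X)), comp_idl; reflexivity.
Qed.

Lemma pure_comp (W V X : C) (r : hom W V) (s : hom V X) :
  pure r >=> pure s = pure (s ∘ r).
Proof. unfold pure at 2 3; rewrite pure_bind, comp_assoc; reflexivity. Qed.

Lemma pure_id_bind (W X : C) (f : kl W X) : pure (idm W) >=> f = f.
Proof.
destruct f as [a f]; change (existT _ a f) with (arr f).
rewrite pure_bind, comp_idr; reflexivity.
Qed.

Lemma bind_pure_id (W X : C) (f : kl W X) : f >=> pure (idm X) = f.
Proof.
destruct f as [a f]; change (existT _ a f) with (arr f).
rewrite bind_pure, fmap_id, comp_idl; reflexivity.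
Qed.

Lemma bind_prefix (W V X Y : C) (f : kl W V) (g : kl V X) (h : kl W X)
    (H : f >=> g = h) (k : kl X Y) : f >=> (g >=> k) = h >=> k.
Proof. rewrite <- kbindA, H; reflexivity. Qed.

(** * The premonoidal structure: left and right whiskering *)

Definition lwhisker (A W X : C) (f : kl W X) : kl (A ⊗ W) (A ⊗ X) :=
  arr (str T (projT1 f) A X ∘ (idm A ⊗₁ projT2 f)).

Notation "A ⋊ f" := (lwhisker A f) (at level 35, right associativity).

(** Conjugating by the symmetry makes the laws of [⋉] follow from those of [⋊]. The grade is
    [pm_one ∗ (projT1 f ∗ pm_one)]; [rwhisker_arr] gives the form of grade [projT1 f] through
    [costr]. *)
Definition rwhisker (W X : C) (f : kl W X) (B : C) : kl (W ⊗ B) (X ⊗ B) :=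
  pure (msym W B) >=> (B ⋊ f) >=> pure (msym B X).

Notation "f ⋉ B" := (rwhisker f B) (at level 36, left associativity).

Lemma tensm_splitl (X X' Y Y' : C) (f : hom X X') (g : hom Y Y') :
  f ⊗₁ g = (idm X' ⊗₁ g) ∘ (f ⊗₁ idm Y).
Proof. rewrite <- tensm_comp, comp_idl, comp_idr; reflexivity. Qed.

Lemma tensm_splitr (X X' Y Y' : C) (f : hom X X') (g : hom Y Y') :
  f ⊗₁ g = (f ⊗₁ idm Y') ∘ (idm X ⊗₁ g).
Proof. rewrite <- tensm_comp, comp_idl, comp_idr; reflexivity. Qed.

Lemma tensm_idl_comp (A X Y W : C) (f : hom X Y) (g : hom Y W) :
  idm A ⊗₁ (g ∘ f) = (idm A ⊗₁ g) ∘ (idm A ⊗₁ f).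
Proof. rewrite <- tensm_comp, comp_idl; reflexivity. Qed.

Lemma lwhisker_bind (A W V X : C) (f : kl W V) (g : kl V X) :
  A ⋊ (f >=> g) = (A ⋊ f) >=> (A ⋊ g).
Proof.
destruct f as [a f], g as [b g]; unfold lwhisker, kbind; simpl; f_equal.
rewrite !tensm_idl_comp, fmap_comp.
rewrite <- (comp_assoc (str T _ _ _)), str_mu', !comp_assoc.
rewrite <- (comp_assoc (str T a A (T b X))), str_nat, !comp_assoc.
reflexivity.
Qed.

Lemma lwhisker_pure (A W X : C) (r : hom W X) : A ⋊ pure r = pure (idm A ⊗₁ r).
Proof.
unfold lwhisker, pure; simpl; rewrite tensm_idl_comp, <- comp_assoc, str_eta'.
reflexivity.
Qed.

(** Naturality of the strength in its first argument, which amounts to the centrality of pure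
    arrows. *)
Lemma lwhisker_nat (A B W X : C) (r : hom A B) (f : kl W X) :
  (A ⋊ f) >=> pure (r ⊗₁ idm X) = pure (r ⊗₁ idm W) >=> (B ⋊ f).
Proof.
destruct f as [a f]; unfold lwhisker; rewrite pure_bind, bind_pure; simpl.
rewrite <- comp_assoc, <- str_nat, fmap_id, !comp_assoc, <- tensm_splitr.
rewrite <- tensm_splitl; reflexivity.
Qed.

Lemma lwhisker_unit (W X : C) (f : kl W X) :
  (munit ⋊ f) >=> pure (mlunit X) = pure (mlunit W) >=> f.
Proof.
destruct f as [a f]; unfold lwhisker; change (existT _ a f) with (arr f).
rewrite pure_bind, bind_pure; simpl.
rewrite <- comp_assoc, str_unit, mlunit_nat; reflexivity.
Qed.

Lemma lwhisker_assoc (A B W X : C) (f : kl W X) :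
  ((A ⊗ B) ⋊ f) >=> pure (massoc A B X) = pure (massoc A B W) >=> (A ⋊ B ⋊ f).
Proof.
destruct f as [a f]; unfold lwhisker; rewrite pure_bind, bind_pure; simpl.
rewrite <- comp_assoc, str_assoc, <- tensm_id, !comp_assoc, massoc_nat.
rewrite tensm_idl_comp, !comp_assoc; reflexivity.
Qed.

Lemma rwhisker_bind (W V X B : C) (f : kl W V) (g : kl V X) :
  (f >=> g) ⋉ B = (f ⋉ B) >=> (g ⋉ B).
Proof.
unfold rwhisker; rewrite lwhisker_bind, !kbindA.
rewrite (bind_prefix (pure_comp _ _)), msym_invol, pure_id_bind; reflexivity.
Qed.

Lemma rwhisker_pure (W X B : C) (r : hom W X) : pure r ⋉ B = pure (r ⊗₁ idm B).
Proof.
unfold rwhisker; rewrite lwhisker_pure, !pure_comp, msym_nat, comp_assoc.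
rewrite msym_invol, comp_idr; reflexivity.
Qed.

Lemma rwhisker_arr (a : G) (W X B : C) (x : hom W (T a X)) :
  arr x ⋉ B = arr (costr T a X B ∘ (x ⊗₁ idm B)).
Proof.
unfold rwhisker, lwhisker, costr; rewrite bind_pure, pure_bind; simpl.
rewrite !comp_assoc, msym_nat; reflexivity.
Qed.

(** The hexagon solved for two of its factors, by cancelling the involutive symmetry of [W] and
    [V]. *)
Lemma hexagon_inv (X V W : C) :
  massoc X W V ∘ (msym W X ⊗₁ idm V)
  = (idm X ⊗₁ msym V W) ∘ (massoc X V W ∘ (msym W (X ⊗ V) ∘ massoc W X V)).
Proof.
rewrite <- (comp_assoc (massoc X V W)), hexagon, <- !comp_assoc, <- tensm_comp.
rewrite msym_invol, comp_idl, tensm_id, comp_idl; reflexivity.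
Qed.

(** The symmetry brings [B] to the left, where the two whiskerings merge into one by [B ⊗ A]. The
    hexagon then splits the symmetry, [lwhisker_nat] carries the swap of [B] and [A] past [f], and
    [lwhisker_assoc] separates the whiskerings again, now by [A] outside and [B] inside. *)
Lemma whisker_assoc (A B W X : C) (f : kl W X) :
  ((A ⋊ f) ⋉ B) >=> pure (massoc A X B) = pure (massoc A W B) >=> (A ⋊ (f ⋉ B)).
Proof.
destruct (massoc_iso B A W) as [ai [Hai Hai']].
assert (E : (B ⋊ A ⋊ f) = pure ai >=> ((B ⊗ A) ⋊ f) >=> pure (massoc B A X)).
{ rewrite lwhisker_assoc, (bind_prefix (pure_comp _ _)), Hai', pure_id_bind.
  reflexivity. }
unfold rwhisker; rewrite E, !kbindA, !pure_comp.
rewrite !lwhisker_bind, !lwhisker_pure, hexagon.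
rewrite <- !pure_comp, (bind_prefix (lwhisker_nat _ _)), !kbindA.
rewrite (bind_prefix (lwhisker_assoc _ _ _)), !kbindA.
rewrite !(bind_prefix (pure_comp _ _)), (comp_prefix (hexagon_inv _ _ _)), !comp_assoc.
rewrite (comp_prefix Hai'), comp_idl, msym_invol, comp_idr; reflexivity.
Qed.

(** * Central arrows and their closure properties *)

Definition central (W X : C) (f : kl W X) : Prop :=
  forall (V Y : C) (g : kl V Y),
    (f ⋉ V) >=> (X ⋊ g) = (W ⋊ g) >=> (f ⋉ Y).

Lemma central_pure (W X : C) (r : hom W X) : central (pure r).
Proof. intros V Y g; rewrite !rwhisker_pure, lwhisker_nat; reflexivity. Qed.

Lemma central_bind (W V X : C) (f : kl W V) (g : kl V X) :
  central f -> central g -> central (f >=> g).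
Proof.
intros Hf Hg U Y h.
rewrite !rwhisker_bind, kbindA, Hg, <- kbindA, Hf, kbindA; reflexivity.
Qed.

Lemma bind_pure_iso_inj (W X Y : C) (r : hom X Y) (f g : kl W X) :
  is_iso r -> f >=> pure r = g >=> pure r -> f = g.
Proof.
intros [s [Hs _]] H.
rewrite <- (bind_pure_id f), <- (bind_pure_id g), <- Hs, <- pure_comp.
rewrite <- !kbindA, H; reflexivity.
Qed.

(** After composition with the invertible associator, every whiskering involved has the form
    [A ⋊ _], and the claim is the interchange law of [f] whiskered by [A]. *)
Lemma central_lwhisker (A W X : C) (f : kl W X) : central f -> central (A ⋊ f).
Proof.
intros Hf V Y g; apply (bind_pure_iso_inj (massoc_iso A X Y)).
rewrite !kbindA, lwhisker_assoc, whisker_assoc.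
rewrite (bind_prefix (whisker_assoc _ _ _)), (bind_prefix (lwhisker_assoc _ _ _)).
rewrite !kbindA, <- !lwhisker_bind, Hf; reflexivity.
Qed.

Definition raise (W X : C) (f : kl W X) (b : G) (h : projT1 f ≼ b) : kl W X :=
  arr (gm_le T h X ∘ projT2 f).

(** The inequality proof in [raise] depends on the arrow and on the grade, so neither can be
    rewritten alone. Proof irrelevance identifies the two proofs once both have been replaced. *)
Lemma raise_ext (W X : C) (f g : kl W X) (b c : G)
    (h : projT1 f ≼ b) (k : projT1 g ≼ c) :
  f = g -> b = c -> raise h = raise k.
Proof. intros E1 E2; subst; f_equal; apply proof_irrelevance. Qed.

Lemma pm_le_refl (a : G) : a ≼ a.
Proof. destruct (pm_order G) as [r _ _]; apply r. Qed.

Lemma raise_bind (W V X : C) (f : kl W V) (g : kl V X) (b c : G)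
    (h : projT1 f ≼ b) (k : projT1 g ≼ c) :
  raise h >=> raise k = raise (f := f >=> g) (pm_mono h k).
Proof.
unfold raise, kbind; simpl; f_equal.
rewrite fmap_comp, !comp_assoc, (comp_prefix (le_mu h k X)), !comp_assoc.
rewrite (comp_prefix (le_nat h _)), !comp_assoc, (comp_prefix (le_nat h _)).
rewrite !comp_assoc; reflexivity.
Qed.

Lemma lwhisker_raise (A W X : C) (f : kl W X) (b : G) (h : projT1 f ≼ b) :
  A ⋊ raise h = raise (f := A ⋊ f) h.
Proof.
unfold raise, lwhisker; simpl; f_equal.
rewrite tensm_idl_comp, <- comp_assoc, str_le, comp_assoc; reflexivity.
Qed.

Lemma raise_refl (W X : C) (f : kl W X) (h : projT1 f ≼ projT1 f) : raise h = f.
Proof.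
destruct f as [a f]; unfold raise; rewrite gm_le_refl, comp_idl; reflexivity.
Qed.

Lemma raise_bindl (W V X : C) (f : kl W V) (g : kl V X) (b : G) (h : projT1 f ≼ b) :
  raise h >=> g
  = raise (f := f >=> g) (pm_mono h (pm_le_refl (projT1 g))).
Proof.
rewrite <- (raise_bind h (pm_le_refl _)), raise_refl; reflexivity.
Qed.

Lemma raise_bindr (W V X : C) (f : kl W V) (g : kl V X) (b : G) (h : projT1 g ≼ b) :
  f >=> raise h
  = raise (f := f >=> g) (pm_mono (pm_le_refl (projT1 f)) h).
Proof.
rewrite <- (raise_bind (pm_le_refl _) h), raise_refl; reflexivity.
Qed.

(** The grade of [f ⋉ B] equals that of [f] only propositionally, so [h] has to be transported. An
    existential is enough, since [raise_ext] accepts any proof. *)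
Lemma rwhisker_raise (W X B : C) (f : kl W X) (b : G) (h : projT1 f ≼ b) :
  exists k, raise h ⋉ B = raise (f := f ⋉ B) (b := b) k.
Proof.
assert (E : pm_one ∗ (projT1 f ∗ pm_one) = projT1 f)
  by (rewrite pm_mul1l, pm_mul1r; reflexivity).
exists (eq_ind_r (fun a => a ≼ b) h E).
unfold rwhisker; rewrite lwhisker_raise.
rewrite (raise_bindl (f := B ⋊ f) (pure (msym B X)) h), raise_bindr.
apply raise_ext; [reflexivity|].
simpl; rewrite pm_mul1l, pm_mul1r; reflexivity.
Qed.

(** Raising passes through whiskering and composition, which leaves the interchange law of [f].
    Equality of graded arrows includes equality of grades, and this part comes from the centrality
    of [b]. *)
Lemma central_raise (W X : C) (f : kl W X) (b : G) (h : projT1 f ≼ b) :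
  is_central b -> central f -> central (raise h).
Proof.
intros Hb Hf V Y g.
destruct (rwhisker_raise V h) as [k ->], (rwhisker_raise Y h) as [k' ->].
rewrite raise_bindl, raise_bindr; apply raise_ext; [apply Hf|].
apply Hb.
Qed.

(** * Centrality as the graded central cone condition *)

Lemma costr_nat (a : G) (X Y Y' : C) (g : hom Y Y') :
  costr T a X Y' ∘ (idm (T a X) ⊗₁ g) = fmap (T a) (idm X ⊗₁ g) ∘ costr T a X Y.
Proof.
unfold costr; rewrite !comp_assoc, msym_nat, <- (fmap_id (T a)).
rewrite (comp_prefix (str_nat T _ _ _)), !comp_assoc, <- (comp_assoc (fmap _ _)).
rewrite <- fmap_comp, msym_nat, fmap_comp, !comp_assoc; reflexivity.
Qed.

Lemma bind_dstr_l (a b : G) (W V X Y : C) (x : hom W (T a X)) (y : hom V (T b Y)) :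
  (arr x ⋉ V) >=> (X ⋊ arr y) = arr (dstr_l T a b X Y ∘ (x ⊗₁ y)).
Proof.
rewrite rwhisker_arr; unfold kbind, lwhisker, dstr_l; simpl; f_equal.
rewrite fmap_comp, !comp_assoc, <- (comp_assoc _ (costr T a X V)), <- costr_nat.
rewrite !comp_assoc, <- tensm_splitl; reflexivity.
Qed.

Lemma bind_dstr_r (a b : G) (W V X Y : C) (x : hom W (T a X)) (y : hom V (T b Y)) :
  (W ⋊ arr y) >=> (arr x ⋉ Y) = arr (dstr_r T a b X Y ∘ (x ⊗₁ y)).
Proof.
rewrite rwhisker_arr; unfold kbind, lwhisker, dstr_r; simpl; f_equal.
rewrite fmap_comp, !comp_assoc, <- (comp_assoc _ (str T b W Y)), <- str_nat.
rewrite fmap_id, !comp_assoc, <- tensm_splitr; reflexivity.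
Qed.

(** The cone condition is interchange with the identity of [T b Y], read as a graded arrow from
    [T b Y] to [Y]. This case is universal: a graded arrow [g] of grade [b] is that one precomposed
    with the pure arrow of [g]. *)
Lemma central_arr (z : center G) (W X : C) (x : hom W (T (center_val z) X)) :
  central (arr x) <->
  forall (Y : C) (b : G),
    gcast T (center_valP z b) (X ⊗ Y)
      ∘ (dstr_l T (center_val z) b X Y ∘ (x ⊗₁ idm (T b Y)))
    = dstr_r T (center_val z) b X Y ∘ (x ⊗₁ idm (T b Y)).
Proof.
split.
- intros H Y b; apply arr_cast; rewrite <- bind_dstr_l, <- bind_dstr_r; apply H.
- intros H V Y [b g]; change (existT _ b g) with (arr g).
  specialize (H Y b); apply arr_cast in H.
  rewrite bind_dstr_l, bind_dstr_r, tensm_splitr, <- !comp_assoc.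
  rewrite <- !(pure_bind (idm W ⊗₁ g)), H; reflexivity.
Qed.

End Kleisli.

Notation "f >=> g" := (kbind f g) (at level 41, right associativity).
Notation "A ⋊ f" := (lwhisker A f) (at level 35, right associativity).
Notation "f ⋉ B" := (rwhisker f B) (at level 36, left associativity).

(** * Factorisation through the terminal cones *)

Section Centre.
Variables (C : SymMonCat) (G : Pomonoid) (T : StrongGradedMonad C G).
Variable K : forall (z : center G) (X : C), GradedCentralCone T z X.
Hypothesis K_terminal : forall (z : center G) (X : C), is_terminal_cone (K z X).

Definition iota (z : center G) (X : C) : hom (cone_ob (K z X)) (T (center_val z) X) :=
  cone_mor (K z X).

Definition kiota (z : center G) (X : C) : kl T (cone_ob (K z X)) X :=
  arr (iota z X).

Lemma central_kiota (z : center G) (X : C) : central (kiota z X).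
Proof. apply central_arr, cone_central. Qed.

(** Terminality is a mere existence statement, whereas the structure maps of the centre are data;
    indefinite description supplies the choice. *)
Lemma lift_sig (z : center G) (W X : C) (x : hom W (T (center_val z) X)) :
  central (arr x) -> {s : hom W (cone_ob (K z X)) | iota z X ∘ s = x}.
Proof.
intros H; apply constructive_indefinite_description.
destruct (K_terminal (Build_GradedCentralCone (proj1 (central_arr x) H)))
  as [[s Hs] _].
exists s; exact Hs.
Qed.

Definition lift (z : center G) (W X : C) (x : hom W (T (center_val z) X))
  (H : central (arr x)) : hom W (cone_ob (K z X)) := proj1_sig (lift_sig H).

Lemma iota_lift (z : center G) (W X : C) (x : hom W (T (center_val z) X))
  (H : central (arr x)) : iota z X ∘ lift H = x.
Proof. exact (proj2_sig (lift_sig H)). Qed.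

(** Precomposing a central arrow with a pure one keeps it central, so [iota z X ∘ g] is itself a
    cone. Both [g] and [h] are cone morphisms from it to the terminal cone, hence equal. *)
Lemma iota_mono (z : center G) (X : C) : is_mono (iota z X).
Proof.
intros W g h E.
assert (H : central (arr (iota z X ∘ g))).
{ rewrite <- pure_bind; apply central_bind; [apply central_pure|].
  apply central_kiota. }
set (L := Build_GradedCentralCone (proj1 (central_arr _) H)).
destruct (K_terminal L) as [f Hf].
pose (g' := exist _ g eq_refl : cone_hom L (K z X)).
pose (h' := exist _ h (eq_sym E) : cone_hom L (K z X)).
exact (f_equal (@proj1_sig _ _) (eq_trans (Hf g') (eq_sym (Hf h')))).
Qed.

Lemma kiota_lift (z : center G) (W X : C) (x : hom W (T (center_val z) X))
  (H : central (arr x)) : pure T (lift H) >=> kiota z X = arr x.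
Proof. unfold kiota; rewrite pure_bind, iota_lift; reflexivity. Qed.

(** The main tool for the laws of the centre: after composition with [kiota], the lemmas [kiota_map]
    to [kiota_le] turn the structure maps into Kleisli operations on [kiota]. *)
Lemma kiota_inj (z : center G) (W X : C) (s t : hom W (cone_ob (K z X))) :
  pure T s >=> kiota z X = pure T t >=> kiota z X -> s = t.
Proof.
unfold kiota; rewrite !pure_bind; intros H; apply arr_inj in H.
exact (iota_mono H).
Qed.

Lemma central_map (z : center G) (X Y : C) (h : hom X Y) :
  central (arr (fmap (T (center_val z)) h ∘ iota z X)).
Proof.
rewrite <- bind_pure; apply central_bind; [apply central_kiota | apply central_pure].
Qed.

Lemma central_eta (X : C) :
  central (arr (T := T) (a := center_val (pm_one : center G)) (eta T X)).
Proof. rewrite <- (comp_idr (eta T X)); exact (central_pure (idm X)). Qed.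

(** The arrow is the Kleisli composite of two instances of [kiota]. *)
Lemma central_mu (z w : center G) (X : C) :
  central (arr (a := center_val (z ∗ w)) (mu T (center_val z) (center_val w) X
    ∘ (fmap (T (center_val z)) (iota w X) ∘ iota z (cone_ob (K w X))))).
Proof.
exact (central_bind (central_kiota z (cone_ob (K w X))) (central_kiota w X)).
Qed.

Lemma central_str (z : center G) (X Y : C) :
  central (arr (str T (center_val z) X Y ∘ (idm X ⊗₁ iota z Y))).
Proof. exact (central_lwhisker X (central_kiota z Y)). Qed.

Lemma central_le (z w : center G) (h : z ≼ w) (X : C) :
  central (arr (gm_le T (h : center_val z ≼ center_val w) X ∘ iota z X)).
Proof.
exact (central_raise (f := kiota z X) h (proj2_sig w) (central_kiota z X)).
Qed.

Definition zmap (z : center G) (X Y : C) (h : hom X Y) :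
  hom (cone_ob (K z X)) (cone_ob (K z Y)) := lift (central_map z h).

Definition zeta (X : C) : hom X (cone_ob (K pm_one X)) := lift (central_eta X).

Definition zmu (z w : center G) (X : C) :
  hom (cone_ob (K z (cone_ob (K w X)))) (cone_ob (K (z ∗ w) X)) :=
  lift (central_mu z w X).

Definition zstr (z : center G) (X Y : C) :
  hom (X ⊗ cone_ob (K z Y)) (cone_ob (K z (X ⊗ Y))) := lift (central_str z X Y).

Definition zle (z w : center G) (h : z ≼ w) (X : C) :
  hom (cone_ob (K z X)) (cone_ob (K w X)) := lift (central_le h X).

(** * The graded monad on the cone objects *)

Lemma kiota_map (z : center G) (X Y : C) (h : hom X Y) :
  pure T (zmap z h) >=> kiota z Y = kiota z X >=> pure T h.
Proof. unfold zmap; rewrite kiota_lift; symmetry; apply bind_pure. Qed.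

Lemma kiota_eta (X : C) : pure T (zeta X) >=> kiota pm_one X = pure T (idm X).
Proof. unfold zeta, pure at 2; rewrite kiota_lift, comp_idr; reflexivity. Qed.

Lemma kiota_mu (z w : center G) (X : C) :
  pure T (zmu z w X) >=> kiota (z ∗ w) X
  = kiota z (cone_ob (K w X)) >=> kiota w X.
Proof. apply kiota_lift. Qed.

Lemma kiota_str (z : center G) (X Y : C) :
  pure T (zstr z X Y) >=> kiota z (X ⊗ Y) = X ⋊ kiota z Y.
Proof. apply kiota_lift. Qed.

Lemma kiota_le (z w : center G) (h : z ≼ w) (X : C) :
  pure T (zle h X) >=> kiota w X
  = raise (f := kiota z X) (b := center_val w) h.
Proof. apply kiota_lift. Qed.

Lemma zmap_id (z : center G) (X : C) : zmap z (idm X) = idm (cone_ob (K z X)).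
Proof.
apply kiota_inj; rewrite kiota_map, bind_pure_id, pure_id_bind; reflexivity.
Qed.

Lemma zmap_comp (z : center G) (X Y W : C) (g : hom Y W) (f : hom X Y) :
  zmap z (g ∘ f) = zmap z g ∘ zmap z f.
Proof.
apply kiota_inj; rewrite <- pure_comp, kbindA, !kiota_map.
rewrite (bind_prefix (kiota_map _ _)), kbindA, pure_comp; reflexivity.
Qed.

Definition zfun (z : center G) : Functor C C :=
  {| fobj := fun X => cone_ob (K z X);
     fmap := zmap z;
     fmap_id := zmap_id z;
     fmap_comp := zmap_comp z |}.

(** The form of [kiota_inj] for laws up to [gcast]; the premise needs no cast because graded arrows
    carry their grade. *)
Lemma kiota_cast (z w : center G) (e : z = w) (W X : C)
    (s : hom W (cone_ob (K z X))) (t : hom W (cone_ob (K w X))) :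
  pure T s >=> kiota z X = pure T t >=> kiota w X -> gcast zfun e X ∘ s = t.
Proof. destruct e; intros H; simpl; rewrite comp_idl; apply kiota_inj, H. Qed.

Lemma zeta_nat (X Y : C) (f : hom X Y) : zeta Y ∘ f = zmap pm_one f ∘ zeta X.
Proof.
apply kiota_inj; rewrite <- !pure_comp, !kbindA, kiota_map, kiota_eta.
rewrite (bind_prefix (kiota_eta _)), pure_id_bind, bind_pure_id; reflexivity.
Qed.

Lemma zmu_nat (z w : center G) (X Y : C) (f : hom X Y) :
  zmu z w Y ∘ zmap z (zmap w f) = zmap (z ∗ w) f ∘ zmu z w X.
Proof.
apply kiota_inj; rewrite <- !pure_comp, !kbindA, kiota_map, kiota_mu.
rewrite (bind_prefix (kiota_map _ _)), (bind_prefix (kiota_mu _ _ _)), !kbindA.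
rewrite kiota_map; reflexivity.
Qed.

Lemma zle_nat (z w : center G) (h : z ≼ w) (X Y : C) (f : hom X Y) :
  zle h Y ∘ zmap z f = zmap w f ∘ zle h X.
Proof.
apply iota_mono; unfold zle, zmap.
rewrite <- !comp_assoc, !iota_lift, !comp_assoc, !iota_lift.
rewrite <- !comp_assoc, le_nat; reflexivity.
Qed.

Lemma zunitl (z : center G) (X : C) :
  gcast zfun (pm_mul1l z) X ∘ (zmu pm_one z X ∘ zeta (cone_ob (K z X)))
  = idm (cone_ob (K z X)).
Proof.
apply kiota_cast; rewrite <- pure_comp, kbindA, kiota_mu.
rewrite (bind_prefix (kiota_eta _)); reflexivity.
Qed.

Lemma zunitr (z : center G) (X : C) :
  gcast zfun (pm_mul1r z) X ∘ (zmu z pm_one X ∘ zmap z (zeta X))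
  = idm (cone_ob (K z X)).
Proof.
apply kiota_cast; rewrite <- pure_comp, kbindA, kiota_mu.
rewrite (bind_prefix (kiota_map _ _)), kbindA, kiota_eta.
rewrite bind_pure_id, pure_id_bind; reflexivity.
Qed.

Lemma zassoc (x y z : center G) (X : C) :
  gcast zfun (pm_mulA x y z) X
    ∘ (zmu (x ∗ y) z X ∘ zmu x y (cone_ob (K z X)))
  = zmu x (y ∗ z) X ∘ zmap x (zmu y z X).
Proof.
apply kiota_cast; rewrite <- !pure_comp, !kbindA, !kiota_mu.
rewrite (bind_prefix (kiota_mu _ _ _)), (bind_prefix (kiota_map _ _)), !kbindA.
rewrite kiota_mu; reflexivity.
Qed.

Lemma zle_refl (z : center G) (h : z ≼ z) (X : C) :
  zle h X = idm (cone_ob (K z X)).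
Proof.
apply kiota_inj; rewrite kiota_le, raise_refl, pure_id_bind; reflexivity.
Qed.

Lemma zle_trans (x y z : center G) (h : x ≼ y) (h' : y ≼ z) (h'' : x ≼ z) (X : C) :
  zle h' X ∘ zle h X = zle h'' X.
Proof.
apply iota_mono; unfold zle; rewrite <- comp_assoc, iota_lift, comp_assoc.
rewrite !iota_lift, <- comp_assoc; f_equal; apply gm_le_trans.
Qed.

Lemma zle_mu (x x' y y' : center G) (h : x ≼ x') (k : y ≼ y') (X : C) :
  zle (pm_mono h k) X ∘ zmu x y X
  = zmu x' y' X ∘ (zle h (cone_ob (K y' X)) ∘ zmap x (zle k X)).
Proof.
(* Naturality puts [zle h] first, so that the right-hand side becomes a composite of two raised
   arrows, which [raise_bind] merges. *)
rewrite zle_nat; apply kiota_inj; rewrite <- !pure_comp, !kbindA, kiota_mu.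
rewrite (bind_prefix (kiota_map _ _)), kbindA, !kiota_le.
rewrite (bind_prefix (kiota_le _ _)), (raise_bind (f := kiota x _) (g := kiota y X)
  (b := center_val x') (c := center_val y') h k).
rewrite raise_bindr.
(* The pure arrow of [zmu] contributes a factor [pm_one] to the grade on the left. *)
apply raise_ext; [apply kiota_mu | apply pm_mul1l].
Qed.

Definition zmonad : GradedMonad C (center G).
Proof.
refine {| gm_fun := zfun;
  gm_eta := {| component := zeta : forall X, hom (functor_id C X) (zfun pm_one X);
               naturality := zeta_nat |};
  gm_mu := fun z w =>
    {| component := zmu z w
         : forall X, hom (functor_comp (zfun z) (zfun w) X) (zfun (z ∗ w) X);
       naturality := @zmu_nat z w |};
  gm_le := fun z w h =>
    {| component := zle h : forall X, hom (zfun z X) (zfun w X);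
       naturality := @zle_nat z w h |} |}.
- exact zunitl.
- exact zunitr.
- exact zassoc.
- exact zle_refl.
- exact zle_trans.
- exact zle_mu.
Defined.

(** * The strength of the centre *)

Lemma zstr_nat (z : center G) (X X' Y Y' : C) (f : hom X X') (g : hom Y Y') :
  zstr z X' Y' ∘ (f ⊗₁ zmap z g) = zmap z (f ⊗₁ g) ∘ zstr z X Y.
Proof.
apply kiota_inj; rewrite (tensm_splitl f (zmap z g)).
rewrite <- !pure_comp, !kbindA, kiota_str, kiota_map.
rewrite (bind_prefix (kiota_str _ _ _)), <- lwhisker_pure, <- lwhisker_bind.
rewrite kiota_map, lwhisker_bind, lwhisker_pure, <- kbindA, <- lwhisker_nat.
rewrite kbindA, pure_comp, <- tensm_splitl; reflexivity.
Qed.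

Lemma zstr_unit (z : center G) (Y : C) :
  zmap z (mlunit Y) ∘ zstr z munit Y = mlunit (cone_ob (K z Y)).
Proof.
apply kiota_inj; rewrite <- pure_comp, kbindA, kiota_map.
rewrite (bind_prefix (kiota_str _ _ _)); apply lwhisker_unit.
Qed.

Lemma zstr_assoc (z : center G) (X Y W : C) :
  zmap z (massoc X Y W) ∘ zstr z (X ⊗ Y) W
  = zstr z X (Y ⊗ W) ∘ (idm X ⊗₁ zstr z Y W) ∘ massoc X Y (cone_ob (K z W)).
Proof.
apply kiota_inj; rewrite <- !pure_comp, !kbindA, kiota_map, kiota_str.
rewrite (bind_prefix (kiota_str _ _ _)), <- lwhisker_pure, <- lwhisker_bind.
rewrite kiota_str; apply lwhisker_assoc.
Qed.

Lemma zstr_eta (X Y : C) :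
  zstr pm_one X Y ∘ (idm X ⊗₁ zeta Y) = zeta (X ⊗ Y).
Proof.
apply kiota_inj; rewrite <- pure_comp, kbindA, kiota_str, kiota_eta.
rewrite <- lwhisker_pure, <- lwhisker_bind, kiota_eta, lwhisker_pure, tensm_id.
reflexivity.
Qed.

Lemma zstr_mu (z w : center G) (X Y : C) :
  zstr (z ∗ w) X Y ∘ (idm X ⊗₁ zmu z w Y)
  = zmu z w (X ⊗ Y) ∘ zmap z (zstr w X Y) ∘ zstr z X (cone_ob (K w Y)).
Proof.
apply kiota_inj; rewrite <- !pure_comp, !kbindA, kiota_str, kiota_mu.
rewrite <- lwhisker_pure, <- lwhisker_bind, kiota_mu, lwhisker_bind.
rewrite (bind_prefix (kiota_map _ _)), !kbindA, kiota_str.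
rewrite (bind_prefix (kiota_str _ _ _)); reflexivity.
Qed.

Lemma zstr_le (z w : center G) (h : z ≼ w) (X Y : C) :
  zstr w X Y ∘ (idm X ⊗₁ zle h Y) = zle h (X ⊗ Y) ∘ zstr z X Y.
Proof.
apply kiota_inj; rewrite <- !pure_comp, !kbindA, kiota_str, kiota_le.
rewrite <- lwhisker_pure, <- lwhisker_bind, kiota_le, lwhisker_raise, raise_bindr.
apply raise_ext; [symmetry; apply kiota_str | symmetry; apply pm_mul1l].
Qed.

Definition zstrong : StrongGradedMonad C (center G) :=
  {| sgm_monad := zmonad;
     str := zstr : forall z X Y, hom (X ⊗ zmonad z Y) (zmonad z (X ⊗ Y));
     str_nat := zstr_nat;
     str_unit := zstr_unit;
     str_assoc := zstr_assoc;
     str_eta := zstr_eta;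
     str_mu := zstr_mu;
     str_le := zstr_le |}.

(** * The inclusion into [T] and commutativity *)

Lemma iota_nat (z : center G) (X Y : C) (f : hom X Y) :
  iota z Y ∘ zmap z f = fmap (T (center_val z)) f ∘ iota z X.
Proof. apply iota_lift. Qed.

Definition iota_nt (z : center G) : NatTrans (zstrong z) (T (center_val z)) :=
  {| component := iota z : forall X, hom (zstrong z X) (T (center_val z) X);
     naturality := @iota_nat z |}.

Definition iota_morphism : CenterMorphism zstrong T.
Proof.
refine {| cm_nat := iota_nt |}.
- intros X; apply iota_lift.
- intros z w X; rewrite comp_assoc; exact (iota_lift (central_mu z w X)).
- intros z X Y; apply iota_lift.
- intros z w h X; apply iota_lift.
Defined.

Definition zcostr (z : center G) (X Y : C) :
  hom (cone_ob (K z X) ⊗ Y) (cone_ob (K z (X ⊗ Y))) := costr zstrong z X Y.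

Lemma kiota_costr (z : center G) (X Y : C) :
  pure T (zcostr z X Y) >=> kiota z (X ⊗ Y) = kiota z X ⋉ Y.
Proof.
change (zcostr z X Y) with
  (zmap z (msym Y X) ∘ zstr z Y X ∘ msym (cone_ob (K z X)) Y).
rewrite <- !pure_comp, !kbindA, kiota_map, (bind_prefix (kiota_str _ _ _)).
reflexivity.
Qed.

(** Over [kiota], the two composites become the two orders of performing [kiota z X] and
    [kiota w Y], which agree because [kiota z X] is central. *)
Lemma zcommutative : is_commutative (@center_comm G) zstrong.
Proof.
intros z w X Y.
change (gcast zfun (center_comm z w) (X ⊗ Y)
  ∘ (zmu z w (X ⊗ Y) ∘ zmap z (zstr w X Y) ∘ zcostr z X (cone_ob (K w Y)))
  = zmu w z (X ⊗ Y) ∘ zmap w (zcostr z X Y) ∘ zstr w (cone_ob (K z X)) Y).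
apply kiota_cast; rewrite <- !pure_comp, !kbindA, !kiota_mu.
rewrite !(bind_prefix (kiota_map _ _)), !kbindA, kiota_str, kiota_costr.
rewrite (bind_prefix (kiota_costr _ _ _)), (bind_prefix (kiota_str _ _ _)).
apply central_kiota.
Qed.

End Centre.

Theorem theorem1 (C : SymMonCat) (G : Pomonoid) (T : StrongGradedMonad C G)
    (T_centralisable : is_centralisable T)
    (K : forall (z : center G) (X : C), GradedCentralCone T z X)
    (K_terminal : forall (z : center G) (X : C), is_terminal_cone (K z X)) :
  exists (S : StrongGradedMonad C (center G)) (iota : CenterMorphism S T),
    (forall (z : center G) (X : C),
       existT (fun W : C => hom W (T (center_val z) X)) (S z X) (iota z X)
       = existT (fun W : C => hom W (T (center_val z) X))
           (cone_ob (K z X)) (cone_mor (K z X)))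
    /\ is_commutative (@center_comm G) S
    /\ is_monomorphism iota.
Proof.
(* Objects and legs agree with those of [K] by computation, so [repeat split] closes the first
   conjunct. *)
exists (zstrong K_terminal), (iota_morphism K_terminal); repeat split.
- apply zcommutative.
- intros z X; exact (iota_mono K_terminal (z := z) (X := X)).
Qed.
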